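(* Let $(X,d)$ be an additive metric space, let $(Y,\rho)$ be a semimetric space, let $\eta\colon[0,\infty)\to[0,\infty)$ be a homeomorphism, and let $f\colon X\to Y$ be a surjective $\eta$-quasisymmetry. Suppose that for all real $t_1,t_2,t_3,t_4,t_5>0$ the inequality $$1+\frac{1}{t_1}\cdot\frac{1}{t_5}\leqslant\max\left\{\frac{1}{t_1}+\frac{1}{t_2},\ \frac{1}{t_3}+\frac{1}{t_4}\right\}$$ implies $$1+\eta\left(\frac{1}{t_1}\right)\eta\left(\frac{1}{t_5}\right)\leqslant\max\left\{\frac{1}{\eta(t_1)}+\frac{1}{\eta(t_2)},\ \frac{1}{\eta(t_3)}+\frac{1}{\eta(t_4)}\right\}.$$ Then $(Y,\rho)$ is also an additive metric space.
   Context: Write $\mathbb{R}^+=[0,\infty)$. A semimetric space is a set $X$ with a function $d\colon X\times X\to\mathbb{R}^+$ such that $d(x,y)=d(y,x)$ and $d(x,y)=0\Leftrightarrow x=y$ for all $x,y\in X$. A metric $d$ on $X$ is additive if $d(x,y)+d(z,u)\leqslant\max\{d(x,z)+d(y,u),\ d(x,u)+d(y,z)\}$ for all $x,y,z,u\in X$. An embedding is an injective continuous mapping whose inverse, defined on the image, is continuous; continuity of a map $g$ between semimetric spaces means that $d(x_n,x)\to0$ implies that the distance between $g(x_n)$ and $g(x)$ tends to $0$. For semimetric spaces $(X,d)$, $(Y,\rho)$ and a homeomorphism $\eta\colon\mathbb{R}^+\to\mathbb{R}^+$, an embedding $f\colon X\to Y$ is an $\eta$-quasisymmetry if $d(x,a)\leqslant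 t\,d(x,b)$ implies $\rho(f(x),f(a))\leqslant\eta(t)\,\rho(f(x),f(b))$ for all $a,b,x\in X$ and all $t\in\mathbb{R}^+$. *)

(* Defs.v *)
From HB Require Import structures.
From mathcomp Require Import all_boot all_order all_algebra.
From mathcomp Require Import all_classical all_reals all_analysis.

Set Implicit Arguments.
Unset Strict Implicit.
Unset Printing Implicit Defensive.

Import Order.TTheory GRing.Theory Num.Theory.
Import numFieldNormedType.Exports.

Local Open Scope classical_set_scope.
Local Open Scope ring_scope.

(* Distances are unbundled functions rather than [metricType] instances: a
   semimetric need not satisfy the triangle inequality, and that [rho] is a
   metric has to be a provable proposition. *)
Definition is_semimetric (R : realType) (X : Type) (d : X -> X -> R) : Prop :=
  [/\ forall x y, 0 <= d x y,
      forall x y, d x y = d y x &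
      forall x y, d x y = 0 <-> x = y].

Definition is_metric (R : realType) (X : Type) (d : X -> X -> R) : Prop :=
  is_semimetric d /\ forall x y z, d x z <= d x y + d y z.

Definition is_additive_metric (R : realType) (X : Type) (d : X -> X -> R) :
    Prop :=
  is_metric d /\
  forall x y z u,
    d x y + d z u <= Num.max (d x z + d y u) (d x u + d y z).

Definition semimetric_continuous (R : realType) (X Y : Type)
    (d : X -> X -> R) (rho : Y -> Y -> R) (g : X -> Y) : Prop :=
  forall (x_ : nat -> X) (x : X),
    d (x_ n) x @[n --> \oo] --> (0 : R) ->
    rho (g (x_ n)) (g x) @[n --> \oo] --> (0 : R).

Definition sub_dist (R : realType) (Y : Type) (rho : Y -> Y -> R) (A : set Y) :
    A -> A -> R :=
  fun y z => rho (\val y) (\val z).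

(* The inverse is a function on the subtype [range f]; a total [g : Y -> X]
   would not exist when [X] is empty and [Y] is not. *)
Definition semimetric_embedding (R : realType) (X Y : Type)
    (d : X -> X -> R) (rho : Y -> Y -> R) (f : X -> Y) : Prop :=
  [/\ injective f,
      semimetric_continuous d rho f &
      exists g : range f -> X,
        (forall y : range f, f (g y) = \val y) /\
        semimetric_continuous (@sub_dist R Y rho (range f)) d g].

Definition homeomorphism_on (T U : topologicalType) (A : set T) (B : set U)
    (f : T -> U) : Prop :=
  exists g : U -> T,
    [/\ set_fun A B f, set_fun B A g,
        {in A, cancel f g} & {in B, cancel g f}] /\
    {within A, continuous f} /\ {within B, continuous g}.

(* A self-homeomorphism of [0, oo) is represented by a function on [R]; its
   values at negative arguments are irrelevant. *)
Definition homeomorphism_Rplus (R : realType) (eta : R -> R) : Prop :=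
  homeomorphism_on (`[0, +oo[ : set R) (`[0, +oo[ : set R) eta.

Definition quasisymmetry (R : realType) (X Y : Type)
    (d : X -> X -> R) (rho : Y -> Y -> R) (eta : R -> R) (f : X -> Y) : Prop :=
  semimetric_embedding d rho f /\
  forall (a b x : X) (t : R), 0 <= t ->
    d x a <= t * d x b -> rho (f x) (f a) <= eta t * rho (f x) (f b).

(* Main.v *)
Require Import Defs.
From HB Require Import structures.
From mathcomp Require Import all_boot all_order all_algebra.
From mathcomp Require Import all_classical all_reals all_analysis.
From mathcomp Require Import ring lra.
Import Order.TTheory GRing.Theory Num.Theory.
Import numFieldNormedType.Exports.
Local Open Scope classical_set_scope.
Local Open Scope ring_scope.

(** Divide the four-point inequality for pairwise distinct [x, y, z, u] by
    [d x y].  Since [d z u / d x y = (d x z / d x y) * (d z u / d z x)], every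
    ratio that occurs then compares two distances issuing from one point, which
    is what a quasisymmetry controls: with
    [t1 = d x y / d x z], [t2 = d y x / d y u], [t3 = d x y / d x u],
    [t4 = d y x / d y z] and [t5 = d z x / d z u], the divided inequality is
    the premise of the implication assumed on [eta].  In its conclusion, the
    left-hand side dominates [1 + rho z u / rho x y], because
    [rho z u <= eta (1 / t5) * rho z x] and [rho x z <= eta (1 / t1) * rho x y];
    and [1 / eta t1 <= rho x z / rho x y], with analogous bounds for
    [t2], [t3], [t4].  Multiplying by [rho x y] gives the four-point inequality
    of [rho] ([quasisymmetry_four_point]).

    The triangle inequality of [rho] corresponds to the limit case [z = u], in
    which [1 / t5] would be [0].  It is approached by taking [t5] large and
    paying for the small positive product [1 / t1 * (1 / t5)] by a slight
    decrease of [t3]; the continuity of [eta] then removes the perturbation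
    ([eta_triangle]).  Once the triangle inequality is known, the four-point
    inequality for quadruples with a repetition follows from it
    ([additive_of_distinct]). *)

Section SemimetricFacts.
Context {R : realType} {Y : Type} (rho : Y -> Y -> R).
Hypothesis hrho : is_semimetric rho.

Lemma semimetric_gt0 x y : x <> y -> 0 < rho x y.
Proof.
case: hrho => ge0 _ eq0 nxy; rewrite lt_def ge0 andbT.
by apply/eqP => /eq0.
Qed.

(** For [x = y] or [z = u] the four-point inequality is a triangle inequality;
    for any other coincidence its left-hand side is one of the two sums on the
    right. *)
Lemma additive_of_distinct :
  (forall x y z, x <> y -> x <> z -> y <> z -> rho x z <= rho x y + rho y z) ->
  (forall x y z u, x <> y -> x <> z -> x <> u -> y <> z -> y <> u -> z <> u ->
     rho x y + rho z u <= Num.max (rho x z + rho y u) (rho x u + rho y z)) ->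
  is_additive_metric rho.
Proof.
case: (hrho) => ge0 sym eq0 tri_distinct four_distinct.
have refl0 x : rho x x = 0 by apply/eq0.
have tri x y z : rho x z <= rho x y + rho y z.
  case: (pselect (x = y)) => [->|nxy]; first by rewrite refl0 add0r.
  case: (pselect (x = z)) => [->|nxz]; first by rewrite refl0 addr_ge0.
  case: (pselect (y = z)) => [->|nyz]; first by rewrite refl0 addr0.
  exact: tri_distinct.
split=> // x y z u.
case: (pselect (x = y)) => [<-|nxy].
  by rewrite refl0 add0r le_max (sym x z) tri.
case: (pselect (z = u)) => [<-|nzu].
  by rewrite refl0 addr0 le_max (sym y z) tri.
case: (pselect (x = z)) => [<-|nxz].
  by rewrite le_max (sym y x) [rho x u + _]addrC lexx orbT.
case: (pselect (x = u)) => [<-|nxu].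
  by rewrite le_max (sym z x) (sym y x) [rho x z + _]addrC lexx.
case: (pselect (y = z)) => [<-|nyz].
  by rewrite le_max lexx.
case: (pselect (y = u)) => [<-|nyu].
  by rewrite le_max (sym z y) lexx orbT.
exact: four_distinct.
Qed.

End SemimetricFacts.

Section HomeomorphismRplus.
Context {R : realType} (eta : R -> R).
Hypothesis heta : homeomorphism_Rplus eta.

Lemma homeomorphism_Rplus_ge0 t : 0 <= t -> 0 <= eta t.
Proof.
case: heta => g [[fun_eta _ _ _] _] t0.
by have := fun_eta t; rewrite /= !in_itv /= !andbT; apply.
Qed.

Lemma homeomorphism_Rplus_continuous t : 0 < t -> {for t, continuous eta}.
Proof.
case: heta => g [_ [cont_eta _]] t0.
have cont_pos : {in [set` (`]0, +oo[%R : interval R)], continuous eta}.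
  rewrite -continuous_open_subspace; last exact: interval_open.
  apply: continuous_subspaceW cont_eta => s /=.
  by rewrite !in_itv /= !andbT; exact: ltW.
by apply: cont_pos; rewrite inE /= in_itv /= t0.
Qed.

Lemma homeomorphism_Rplus_le_left t c :
  0 < t -> (forall s, 0 < s -> s < t -> eta s <= c) -> eta t <= c.
Proof.
move=> t0 bound.
have lim_eta : eta s @[s --> t^'-] --> eta t.
  by apply: cvg_at_left_filter; exact: homeomorphism_Rplus_continuous.
apply: (cvgr_to_le lim_eta).
near=> s; apply: bound; first by near: s; exact: nbhs_left_gt.
by near: s; exact: nbhs_left_lt.
Unshelve. all: by end_near. Qed.

End HomeomorphismRplus.

(** The implication between five-parameter inequalities, read with
    [ti = d / d'] for two distances [d], [d'] issuing from a common point: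
    it transports the four-point inequality, divided by one of its six
    distances, along [eta]. *)
Definition four_point_transport {R : realType} (eta : R -> R) : Prop :=
  forall t1 t2 t3 t4 t5 : R,
    0 < t1 -> 0 < t2 -> 0 < t3 -> 0 < t4 -> 0 < t5 ->
    1 + 1 / t1 * (1 / t5) <= Num.max (1 / t1 + 1 / t2) (1 / t3 + 1 / t4) ->
    1 + eta (1 / t1) * eta (1 / t5) <=
      Num.max (1 / eta t1 + 1 / eta t2) (1 / eta t3 + 1 / eta t4).

(** If the conclusion failed, the implication applied with [t3] slightly below
    [t1] would force [1 <= 1 / eta t3 + 1 / eta t2], that is, an upper bound for
    [eta t3]; by continuity the same bound holds for [eta t1], a
    contradiction. *)
Lemma eta_triangle {R : realType} (eta : R -> R) (t1 t2 : R) :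
  homeomorphism_Rplus eta -> four_point_transport eta ->
  0 < t1 -> 0 < t2 -> 0 < eta t1 ->
  1 <= 1 / t1 + 1 / t2 -> 1 <= 1 / eta t1 + 1 / eta t2.
Proof.
move=> heta himp t1_gt0 t2_gt0 eta1_gt0 tri.
rewrite leNgt; apply/negP => lt1.
have inv_eta1_gt0 : 0 < 1 / eta t1 by rewrite divr_gt0.
pose c := 1 - 1 / eta t2.
have c_gt0 : 0 < c by rewrite /c; lra.
suff : eta t1 <= 1 / c.
  rewrite ler_pdivlMr // mulrC -ler_pdivlMr // /c; lra.
apply: (homeomorphism_Rplus_le_left eta heta) => // s s_gt0 s_lt.
have ts_gt0 : 0 < t1 - s by rewrite subr_gt0.
(* [t5 = s / (t1 - s)] makes [1 / t1 * (1 / t5)] equal to the increase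
   [1 / s - 1 / t1] of the right-hand side. *)
have t5E : 1 / t1 * (1 / (s / (t1 - s))) = 1 / s - 1 / t1.
  by field; rewrite !gt_eqF.
have := himp t1 t2 s t2 (s / (t1 - s)) t1_gt0 t2_gt0 s_gt0 t2_gt0
  (divr_gt0 s_gt0 ts_gt0).
have premise : 1 + (1 / s - 1 / t1) <=
    Num.max (1 / t1 + 1 / t2) (1 / s + 1 / t2).
  by rewrite le_max; apply/orP; right; lra.
rewrite t5E => /(_ premise).
have eta_inv_ge0 t : 0 < t -> 0 <= eta (1 / t).
  by move=> t0; apply: homeomorphism_Rplus_ge0 => //; rewrite divr_ge0 // ltW.
have prod_ge0 : 0 <= eta (1 / t1) * eta (1 / (s / (t1 - s))).
  by rewrite mulr_ge0 // eta_inv_ge0 // divr_gt0.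
rewrite le_max => /orP[|bound]; first by lra.
have {}bound : c <= 1 / eta s by rewrite /c; lra.
have eta_s_gt0 : 0 < eta s.
  rewrite -invr_gt0 -div1r; exact: lt_le_trans bound.
by rewrite ler_pdivlMr // mulrC -ler_pdivlMr.
Qed.

Section Quasisymmetry.
Context {R : realType} {X Y : Type} (d : X -> X -> R) (rho : Y -> Y -> R).
Context (eta : R -> R) (f : X -> Y).
Hypothesis hd : is_additive_metric d.
Hypothesis hrho : is_semimetric rho.
Hypothesis hf : quasisymmetry d rho eta f.

Let d_gt0 x y : x <> y -> 0 < d x y.
Proof. by apply: semimetric_gt0; case: hd => -[]. Qed.

Let rho_gt0 x y : x <> y -> 0 < rho (f x) (f y).
Proof.
by move=> nxy; apply: semimetric_gt0 => //; case: hf => -[inj _ _] _ /inj.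
Qed.

Lemma quasisymmetry_ratio x a b :
  x <> b -> rho (f x) (f a) <= eta (d x a / d x b) * rho (f x) (f b).
Proof.
move=> nxb; case: hf => _; apply.
  by rewrite divr_ge0 //; case: hd => -[[]].
by rewrite divfK // gt_eqF // d_gt0.
Qed.

Lemma quasisymmetry_eta_gt0 x a b :
  x <> a -> x <> b -> 0 < eta (d x a / d x b).
Proof.
move=> nxa nxb; rewrite -(pmulr_lgt0 _ (rho_gt0 x b nxb)).
exact: lt_le_trans (rho_gt0 x a nxa) (quasisymmetry_ratio x a b nxb).
Qed.

(** The same control with the roles of [a] and [b] exchanged: it bounds ratios
    of [rho] from below by the quantities [1 / eta t] of the transported
    inequality. *)
Lemma quasisymmetry_inv_eta x a b :
  x <> a -> x <> b ->
  (eta (d x a / d x b))^-1 * rho (f x) (f a) <= rho (f x) (f b).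
Proof.
move=> nxa nxb; rewrite mulrC ler_pdivrMr ?quasisymmetry_eta_gt0 // mulrC.
exact: quasisymmetry_ratio.
Qed.

Hypothesis heta : homeomorphism_Rplus eta.
Hypothesis himp : four_point_transport eta.

Lemma quasisymmetry_triangle x y z :
  x <> y -> x <> z -> y <> z ->
  rho (f x) (f z) <= rho (f x) (f y) + rho (f y) (f z).
Proof.
move=> nxy nxz nyz.
have [nzx nzy] := (nesym nxz, nesym nyz).
case: (hd) => -[[_ dsym _] tri] _; case: (hrho) => _ rsym _.
have transported : 1 <= 1 / eta (d x z / d x y) + 1 / eta (d z x / d z y).
  apply: eta_triangle => //; rewrite ?divr_gt0 ?d_gt0 //.
    exact: quasisymmetry_eta_gt0.
  rewrite !div1r !invf_div (dsym z x) -mulrDl.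
  by rewrite ler_pdivlMr ?d_gt0 // mul1r (dsym z y).
rewrite -(ler_pM2r (rho_gt0 x z nxz)) !div1r mul1r in transported.
apply: le_trans transported _; rewrite mulrDl lerD //.
  exact: quasisymmetry_inv_eta.
by rewrite (rsym (f x)) (rsym (f y)); exact: quasisymmetry_inv_eta.
Qed.

(** [d z u] is compared with [d x y] through [d x z], which shares a point with
    each; this factorisation is the origin of the product
    [eta (1 / t1) * eta (1 / t5)]. *)
Lemma quasisymmetry_four_point x y z u :
  x <> y -> x <> z -> x <> u -> y <> z -> y <> u -> z <> u ->
  rho (f x) (f y) + rho (f z) (f u) <=
    Num.max (rho (f x) (f z) + rho (f y) (f u))
            (rho (f x) (f u) + rho (f y) (f z)).
Proof.
move=> nxy nxz nxu nyz nyu nzu.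
have [nyx nzx] := (nesym nxy, nesym nxz).
case: (hd) => -[[_ dsym _] _] four; case: (hrho) => rge0 rsym _.
have ratio_gt0 v a b : v <> a -> v <> b -> 0 < d v a / d v b.
  by move=> nva nvb; rewrite divr_gt0 // d_gt0.
have [xy_gt0 xz_gt0] := (d_gt0 x y nxy, d_gt0 x z nxz).
have := himp _ _ _ _ _ (ratio_gt0 x y z nxy nxz) (ratio_gt0 y x u nyx nyu)
  (ratio_gt0 x y u nxy nxu) (ratio_gt0 y x z nyx nyz) (ratio_gt0 z x u nzx nzu).
rewrite !div1r !invf_div (dsym y x) (dsym z x).
have -> : d x z / d x y * (d z u / d x z) = d z u / d x y.
  by field; rewrite !gt_eqF.
have premise : 1 + d z u / d x y <=
    Num.max (d x z / d x y + d y u / d x y) (d x u / d x y + d y z / d x y).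
  rewrite -!mulrDl -maxr_pMl ?invr_ge0 ?(ltW xy_gt0) // ler_pdivlMr //.
  by rewrite mulrDl divfK ?gt_eqF // mul1r four.
move=> /(_ premise).
rewrite -(ler_pM2r (rho_gt0 x y nxy)) maxr_pMl ?(ltW (rho_gt0 x y nxy)) //.
rewrite !mulrDl mul1r => transported.
have zu_le : rho (f z) (f u) <=
    eta (d x z / d x y) * eta (d z u / d x z) * rho (f x) (f y).
  apply: le_trans (quasisymmetry_ratio z u x nzx) _.
  rewrite (dsym z x) (rsym (f z)) [eta (d x z / _) * _]mulrC -mulrA.
  apply: ler_wpM2l (quasisymmetry_ratio x z y nxy).
  by rewrite -(dsym z x) ltW // quasisymmetry_eta_gt0.
have inv_xz := quasisymmetry_inv_eta x y z nxy nxz.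
have inv_xu := quasisymmetry_inv_eta x y u nxy nxu.
have inv_yu := quasisymmetry_inv_eta y x u nyx nyu.
have inv_yz := quasisymmetry_inv_eta y x z nyx nyz.
rewrite (dsym y x) (rsym (f y) (f x)) in inv_yu inv_yz.
apply: le_trans (lerD (lexx _) zu_le) _.
apply: le_trans transported _.
rewrite ge_max !le_max.
by rewrite (lerD inv_xz inv_yu) (lerD inv_xu inv_yz) orbT.
Qed.

End Quasisymmetry.

Theorem theorem4p1 (R : realType) (X Y : Type)
    (d : X -> X -> R) (rho : Y -> Y -> R) (eta : R -> R) (f : X -> Y)
    (hd : is_additive_metric d)
    (hrho : is_semimetric rho)
    (heta : homeomorphism_Rplus eta)
    (hf : quasisymmetry d rho eta f)
    (hsurj : set_surj [set: X] [set: Y] f)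
    (himp : forall t1 t2 t3 t4 t5 : R,
      0 < t1 -> 0 < t2 -> 0 < t3 -> 0 < t4 -> 0 < t5 ->
      1 + 1 / t1 * (1 / t5) <= Num.max (1 / t1 + 1 / t2) (1 / t3 + 1 / t4) ->
      1 + eta (1 / t1) * eta (1 / t5) <=
        Num.max (1 / eta t1 + 1 / eta t2) (1 / eta t3 + 1 / eta t4)) :
  is_additive_metric rho.
Proof.
have lift y : exists x, f x = y by have [x _ <-] := hsurj y I; exists x.
have neq a b : f a <> f b -> a <> b by move=> nab /(congr1 f).
apply: (additive_of_distinct rho hrho).
  move=> y1 y2 y3; have [x1 <-] := lift y1; have [x2 <-] := lift y2.
  have [x3 <-] := lift y3 => /neq n12 /neq n13 /neq n23.
  exact: (quasisymmetry_triangle d rho eta f).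
move=> y1 y2 y3 y4; have [x1 <-] := lift y1; have [x2 <-] := lift y2.
have [x3 <-] := lift y3; have [x4 <-] := lift y4.
move=> /neq n12 /neq n13 /neq n14 /neq n23 /neq n24 /neq n34.
exact: (quasisymmetry_four_point d rho eta f).
Qed.
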